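(* Let $X^n$ and $Y^n$ be the inputs and outputs of a discrete channel with additive noise feedback $Z_i=Y_i+V_i$, and let $W$ be the message. Then $$I(X^n\rightarrow Y^n)=I(W;Y^n)+I(V^{n-1};Y^n)+I(W;V^{n-1}|Y^n).$$
   Context: All random variables take values in finite sets; $x^n=(x_1,\dots,x_n)$, $x^0=\emptyset$. Setup: variables are generated in the order $W,X_1,Y_1,V_1,X_2,Y_2,V_2,\dots,V_{n-1},X_n,Y_n$. At time $i$ a deterministic encoder produces $X_i$ as a function of $(W,Z^{i-1})$, where $Z_j=Y_j+V_j$ (addition in an abelian group containing the alphabets of $Y$ and $V$). Given all of the past, $Y_i$ has law $p(y_i|x^i,y^{i-1})$. The feedback noise is independent of the message and is not influenced by the channel: given all of the past $(W,X^i,Y^i,V^{i-1})$, $V_i$ has law $p(v_i|v^{i-1})$. Directed information: $I(X^n\rightarrow Y^n)=\sum_{i=1}^n I(X^i;Y_i|Y^{i-1})$. *)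

(* Defs.v *)
(* MathComp / MathComp-Analysis. *)
From HB Require Import structures.
From mathcomp Require Import all_boot all_order all_algebra.
From mathcomp Require Import all_classical all_reals all_analysis.

Set Implicit Arguments.
Unset Strict Implicit.
Unset Printing Implicit Defensive.

Import Order.TTheory GRing.Theory Num.Theory.

Local Open Scope classical_set_scope.
Local Open Scope ring_scope.

(* Information is measured in bits. *)
Definition log2 (R : realType) (x : R) : R := ln x / ln 2.

(* Measurability of a finite-valued random variable, the finite alphabet
   carrying its discrete sigma-algebra. *)
Definition finite_rv (d : measure_display) (T : measurableType d) (A : finType)
    (X : T -> A) : Prop :=
  forall a : A, measurable (X @^-1` [set a]).

Definition pair_rv (T A B : Type) (X : T -> A) (Y : T -> B) : T -> A * B :=
  fun t => (X t, Y t).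

(* Processes are indexed from 0: [history X i] is the tuple of the first [i]
   variables, written x^i = (x_1, ..., x_i) when time starts at 1. *)
Definition history (T A : Type) (X : nat -> T -> A) (i : nat) : T -> i.-tuple A :=
  fun t => [tuple X j t | j < i].

Section Information.
Context {d : measure_display} {T : measurableType d} {R : realType}.
Variable P : probability T R.

Definition law (A : Type) (X : T -> A) (a : A) : R :=
  fine (P (X @^-1` [set a])).

(* P(X = a | C = c), with the junk value 0 when P(C = c) = 0. *)
Definition cond_law (A C : Type) (X : T -> A) (U : T -> C) (a : A) (c : C) : R :=
  law (pair_rv X U) (a, c) / law U c.

(* In both sums the convention 0 log 0 = 0 holds automatically: a term of
   zero joint probability is multiplied by 0, and in every other term all the
   probabilities involved are positive. *)
Definition mutual_info (A B : finType) (X : T -> A) (Y : T -> B) : R :=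
  \sum_(a : A) \sum_(b : B)
    law (pair_rv X Y) (a, b) *
    log2 (law (pair_rv X Y) (a, b) / (law X a * law Y b)).

Definition cond_mutual_info (A B C : finType)
    (X : T -> A) (Y : T -> B) (U : T -> C) : R :=
  \sum_(a : A) \sum_(b : B) \sum_(c : C)
    law (pair_rv (pair_rv X Y) U) (a, b, c) *
    log2 (cond_law (pair_rv X Y) U (a, b) c /
          (cond_law X U a c * cond_law Y U b c)).

(* The summand at index [i] is I(X^{i+1}; Y_{i+1} | Y^i) for 1-based time. *)
Definition directed_info (A B : finType) (X : nat -> T -> A) (Y : nat -> T -> B)
    (n : nat) : R :=
  \sum_(i < n) cond_mutual_info (history X i.+1) (Y i) (history Y i).

End Information.

Definition is_pmf (R : realType) (A : finType) (p : A -> R) : Prop :=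
  (forall a, 0 <= p a) /\ \sum_(a : A) p a = 1.

(* Z_j = Y_j + V_j, computed in an abelian group [G] in which the alphabets
   [AY] and [AV] are embedded. *)
Definition noisy_feedback (T AY AV : Type) (G : zmodType)
    (iY : AY -> G) (iV : AV -> G) (Y : nat -> T -> AY) (V : nat -> T -> AV) :
    nat -> T -> G :=
  fun j t => iY (Y j t) + iV (V j t).

(* Use of a channel over a block of [n] symbols with additive noise feedback,
   the variables being generated in the order
     W, X_0, Y_0, V_0, X_1, ..., V_{n-2}, X_{n-1}, Y_{n-1};
   the values of the processes beyond these indices are unconstrained.
   The kernels are [chan i x^{i+1} y^i] for Y_i and [noise i v^i] for V_i. *)
Record noise_feedback_channel (d : measure_display) (T : measurableType d)
    (R : realType) (P : probability T R) (AW AX AY AV : finType) (G : zmodType)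
    (n : nat) (iY : AY -> G) (iV : AV -> G)
    (enc : forall i : nat, AW -> i.-tuple G -> AX)
    (chan : forall i : nat, i.+1.-tuple AX -> i.-tuple AY -> AY -> R)
    (noise : forall i : nat, i.-tuple AV -> AV -> R)
    (W : T -> AW) (X : nat -> T -> AX) (Y : nat -> T -> AY) (V : nat -> T -> AV) :
    Prop := NoiseFeedbackChannel {
  nfc_embY : injective iY;
  nfc_embV : injective iV;
  nfc_rvW : finite_rv W;
  nfc_rvX : forall i, (i < n)%N -> finite_rv (X i);
  nfc_rvY : forall i, (i < n)%N -> finite_rv (Y i);
  nfc_rvV : forall i, (i < n.-1)%N -> finite_rv (V i);
  nfc_chan_pmf : forall i, (i < n)%N -> forall xs ys, is_pmf (chan i xs ys);
  nfc_noise_pmf : forall i, (i < n.-1)%N -> forall vs, is_pmf (noise i vs);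
  nfc_encoder : forall i, (i < n)%N ->
    {ae P, forall t,
      X i t = enc i (W t) (history (noisy_feedback iY iV Y V) i t)};
  nfc_channel : forall i, (i < n)%N ->
    let past := pair_rv (pair_rv (pair_rv W (history X i.+1)) (history Y i))
                        (history V i) in
    forall w xs ys vs y, law P past (w, xs, ys, vs) != 0 ->
      cond_law P (Y i) past y (w, xs, ys, vs) = chan i xs ys y;
  nfc_noise : forall i, (i < n.-1)%N ->
    let past := pair_rv (pair_rv (pair_rv W (history X i.+1)) (history Y i.+1))
                        (history V i) in
    forall w xs ys vs v, law P past (w, xs, ys, vs) != 0 ->
      cond_law P (V i) past v (w, xs, ys, vs) = noise i vs v
}.

(* Main.v *)
(* Both sides are expectations of the same function of (W, X^n, Y^n, V^(n-1)).
   Wherever these variables have positive joint probability,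
     p(w, v^(n-1), y^n) = p(w) p(v^(n-1)) prod_i p(y_i | x^i, y^(i-1)),
   because the encoder determines x^n from (w, v^(n-1), y^n) and the noise is
   driven by its own past only.  Hence log (p(w, v, y) / (p(w) p(v) p(y))), to
   which the three densities on the right add up, equals
   sum_i log (p(y_i | x^i, y^(i-1)) / p(y_i | y^(i-1))), the density of the
   directed information.  All probabilities are computed on the finite set of
   values of (W, X^n, Y^n, V^(n-1)), through which every variable factors. *)
Require Import Defs.
From HB Require Import structures.
From mathcomp Require Import all_boot all_order all_algebra.
From mathcomp Require Import all_classical all_reals all_analysis.
From mathcomp Require Import ring.

Set Implicit Arguments.
Unset Strict Implicit.
Unset Printing Implicit Defensive.

Import Order.TTheory GRing.Theory Num.Theory.
Local Open Scope ring_scope.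

(** * Logarithms, and equality of histories and of pairs *)

Lemma log2M (R : realType) (x y : R) :
  0 < x -> 0 < y -> log2 (x * y) = log2 x + log2 y.
Proof. by move=> x0 y0; rewrite /log2 lnM ?posrE// mulrDl. Qed.

Lemma history_eqP (T A : Type) (X : nat -> T -> A) (i : nat) (t u : T) :
  history X i t = history X i u <-> forall j, (j < i)%N -> X j t = X j u.
Proof.
split=> [e j ji|e].
  have := congr1 (fun v => tnth v (Ordinal ji)) e.
  by rewrite !tnth_mktuple.
by apply: eq_from_tnth => j; rewrite !tnth_mktuple; exact: e.
Qed.

Lemma historyS_eqP (T A : Type) (X : nat -> T -> A) (i : nat) (t u : T) :
  history X i.+1 t = history X i.+1 u <->
  X i t = X i u /\ history X i t = history X i u.
Proof.
split=> [/history_eqP e|[e /history_eqP h]].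
  by split; [exact: e | apply/history_eqP => j ji; apply: e; exact: ltnW].
apply/history_eqP => j; rewrite ltnS leq_eqVlt => /predU1P[->//|]; exact: h.
Qed.

Lemma history_eq_le (T A : Type) (X : nat -> T -> A) (i j : nat) (t u : T) :
  (i <= j)%N -> history X j t = history X j u -> history X i t = history X i u.
Proof.
move=> ij /history_eqP e; apply/history_eqP => k ki; apply: e.
exact: leq_trans ij.
Qed.

Lemma history0_eq (T A : Type) (X : nat -> T -> A) (t u : T) :
  history X 0 t = history X 0 u.
Proof. by apply/history_eqP. Qed.

Lemma pair_rv_eqP (T A B : Type) (X : T -> A) (Y : T -> B) (t u : T) :
  pair_rv X Y t = pair_rv X Y u <-> X t = X u /\ Y t = Y u.
Proof. by split=> [[-> ->]|[e e']]; rewrite ?/pair_rv ?e ?e'. Qed.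

(** * Laws of variables on a finite set with weight [mu] *)

Section FiniteSpace.
Context {R : realType} {Om : finType}.
Variable mu : Om -> R.
Hypothesis mu_ge0 : forall s, 0 <= mu s.
Hypothesis mu_sum1 : \sum_s mu s = 1.

Definition pr (A : eqType) (U : Om -> A) (a : A) : R := \sum_(s | U s == a) mu s.

Lemma pr_ge0 (A : eqType) (U : Om -> A) (a : A) : 0 <= pr U a.
Proof. exact: sumr_ge0. Qed.

Lemma pr_gt0 (A : eqType) (U : Om -> A) (s : Om) : mu s != 0 -> 0 < pr U (U s).
Proof.
move=> s0; rewrite /pr (bigD1 s)//= ltr_wpDr ?sumr_ge0// lt_neqAle.
by rewrite eq_sym s0 mu_ge0.
Qed.

Lemma pr_comp (A B : finType) (U : Om -> A) (f : A -> B) (b : B) :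
  pr (f \o U) b = \sum_(a | f a == b) pr U a.
Proof.
rewrite /pr (partition_big U (fun a => f a == b))//=.
apply: eq_bigr => a /eqP fa; apply: eq_bigl => s.
by case: (U s =P a) => [->|]; rewrite ?andbF ?fa ?eqxx.
Qed.

Lemma pr_expectation (A : finType) (U : Om -> A) (f : A -> R) :
  \sum_a pr U a * f a = \sum_s mu s * f (U s).
Proof.
rewrite [RHS](partition_big U xpredT)//=; apply: eq_bigr => a _.
by rewrite mulr_suml; apply: eq_bigr => s /eqP ->.
Qed.

(** Only the fibre through [s], taken within the support of [mu], matters. This allows tuples to be
    regrouped, and components determined by the others to be added or dropped. *)
Lemma pr_eq_fiber (A B : eqType) (U : Om -> A) (U' : Om -> B) (s : Om) :
  (forall s', mu s' != 0 -> U s' = U s <-> U' s' = U' s) ->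
  pr U (U s) = pr U' (U' s).
Proof.
move=> h; rewrite /pr [LHS]big_mkcond [RHS]big_mkcond/=; apply: eq_bigr => s' _.
have [->|/h e] := eqVneq (mu s') 0; first by rewrite !if_same.
by congr (if _ then _ else _); apply/eqP/eqP => /e.
Qed.

Lemma pr_cst (A : eqType) (U : Om -> A) (s : Om) :
  (forall s', U s' = U s) -> pr U (U s) = 1.
Proof. by move=> h; rewrite /pr -mu_sum1; apply: eq_bigl => s'; rewrite h eqxx. Qed.

Lemma pr_pair_eq0 (A B : eqType) (Y : Om -> B) (U : Om -> A) (a : A) (y : B) :
  pr U a = 0 -> pr (pair_rv Y U) (y, a) = 0.
Proof.
move=> U0; apply/eqP; rewrite eq_le pr_ge0 andbT -U0 /pr.
rewrite [leLHS]big_mkcond [leRHS]big_mkcond; apply: ler_sum => s _.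
rewrite /pair_rv xpair_eqE; case: (Y s == y) => //=.
by case: ifP.
Qed.

(* If the law of [Y] given [U] only depends on [f U], then it is also the law
   of [Y] given [f U]. *)
Lemma pr_kernel_comp (A B C : finType) (U : Om -> A) (f : A -> B) (Y : Om -> C)
    (k : B -> C -> R) :
  (forall a y, pr U a != 0 -> pr (pair_rv Y U) (y, a) / pr U a = k (f a) y) ->
  forall b y, pr (pair_rv Y (f \o U)) (y, b) = pr (f \o U) b * k b y.
Proof.
move=> h b y; rewrite pr_comp mulr_suml.
have -> : pair_rv Y (f \o U) = (fun p => (p.1, f p.2)) \o pair_rv Y U by [].
rewrite pr_comp (eq_bigl (fun p => (p.1 == y) && (f p.2 == b))); last first.
  by move=> [c a]; rewrite xpair_eqE.
rewrite -(pair_big (fun c => c == y) (fun a => f a == b)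
  (fun c a => pr (pair_rv Y U) (c, a)))/= big_pred1_eq.
apply: eq_bigr => a /eqP fa; have [e|e] := eqVneq (pr U a) 0.
  by rewrite pr_pair_eq0// e mul0r.
by rewrite -fa -h// mulrC divfK.
Qed.

(** * The feedback channel on the finite set *)

Context {AW AX AY AV : finType} {G : zmodType}.
Variables (n : nat) (iY : AY -> G) (iV : AV -> G).
Variables (enc : forall i : nat, AW -> i.-tuple G -> AX)
  (chan : forall i : nat, i.+1.-tuple AX -> i.-tuple AY -> AY -> R)
  (noise : forall i : nat, i.-tuple AV -> AV -> R).
Variables (W : Om -> AW) (X : nat -> Om -> AX) (Y : nat -> Om -> AY)
  (V : nat -> Om -> AV).
Hypothesis n_gt0 : (0 < n)%N.

Let before_output i := pair_rv (pair_rv (pair_rv W (history X i.+1)) (history Y i))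
                       (history V i).
Let before_noise i := pair_rv (pair_rv (pair_rv W (history X i.+1)) (history Y i.+1))
                       (history V i).

Hypothesis encoder : forall i, (i < n)%N -> forall s, mu s != 0 ->
  X i s = enc (W s) (history (noisy_feedback iY iV Y V) i s).
Hypothesis channel : forall i, (i < n)%N -> forall a y,
  pr (before_output i) a != 0 ->
  pr (pair_rv (Y i) (before_output i)) (y, a) / pr (before_output i) a =
  chan a.1.1.2 a.1.2 y.
Hypothesis noiseP : forall i, (i < n.-1)%N -> forall a v,
  pr (before_noise i) a != 0 ->
  pr (pair_rv (V i) (before_noise i)) (v, a) / pr (before_noise i) a =
  noise a.2 v.

(** The product of these factors over time is the causally conditioned probability of the outputs
    given the inputs. *)
Let gain i s := chan (history X i.+1 s) (history Y i s) (Y i s).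

(** The encoder reads the message and strictly earlier feedback only, so the last of the [m] inputs
    involves [m.-1] feedback symbols. *)
Lemma encoder_fiber (m : nat) (s s' : Om) : (m <= n)%N -> mu s != 0 -> mu s' != 0 ->
  W s' = W s -> history Y m.-1 s' = history Y m.-1 s ->
  history V m.-1 s' = history V m.-1 s -> history X m s' = history X m s.
Proof.
move=> mn s0 s'0 eW /history_eqP eY /history_eqP eV; apply/history_eqP => j jm.
rewrite !encoder ?(leq_trans jm)// eW; congr enc; apply/history_eqP => k kj.
have km : (k < m.-1)%N by rewrite (leq_trans kj)// -ltnS prednK ?(leq_ltn_trans _ jm).
by rewrite /noisy_feedback eY ?eV.
Qed.

Lemma pr_output (i : nat) (s : Om) : (i < n)%N ->
  pr (pair_rv (Y i) (before_output i)) (Y i s, before_output i s) =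
  pr (before_output i) (before_output i s) * gain i s.
Proof.
move=> ni; have := @pr_kernel_comp _ _ _ (before_output i) id (Y i)
  (fun a y => chan a.1.1.2 a.1.2 y) (channel ni).
exact.
Qed.

(** The channel kernel ignores the message and the noise, so both can be averaged out of the
    conditioning. *)
Lemma pr_output_input (i : nat) (s : Om) : (i < n)%N ->
  pr (pair_rv (Y i) (pair_rv (history X i.+1) (history Y i)))
    (Y i s, (history X i.+1 s, history Y i s)) =
  pr (pair_rv (history X i.+1) (history Y i)) (history X i.+1 s, history Y i s)
    * gain i s.
Proof.
move=> ni; have := @pr_kernel_comp _ _ _ (before_output i)
  (fun a => (a.1.1.2, a.1.2)) (Y i) (fun a y => chan a.1 a.2 y) (channel ni).
exact.
Qed.

Lemma pr_noise (i : nat) (s : Om) : (i < n.-1)%N ->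
  pr (pair_rv (V i) (before_noise i)) (V i s, before_noise i s) =
  pr (before_noise i) (before_noise i s) * noise (history V i s) (V i s).
Proof.
move=> ni; have := @pr_kernel_comp _ _ _ (before_noise i) id (V i)
  (fun a y => noise a.2 y) (noiseP ni).
exact.
Qed.

(** The noise kernel sees only past noise; averaging out message, inputs and outputs leaves the
    chain rule for the noise process alone. *)
Lemma pr_noise_history (i : nat) (s : Om) : (i < n.-1)%N ->
  pr (history V i.+1) (history V i.+1 s) =
  pr (history V i) (history V i s) * noise (history V i s) (V i s).
Proof.
move=> ni; have h := @pr_kernel_comp _ _ _ (before_noise i) snd (V i)
  (fun a y => noise a y) (noiseP ni).
rewrite -[RHS]h; apply: (@pr_eq_fiber _ _ _ (pair_rv (V i) (history V i))) => s' _.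
by rewrite historyS_eqP pair_rv_eqP.
Qed.

(** Induction in the order of generation: [Y m] contributes a gain, [V m] a noise factor absorbed by
    the law of the noise, and the next input nothing, being determined by the encoder. *)
Lemma pr_joint_history (m : nat) (s : Om) : (m <= n.-1)%N -> mu s != 0 ->
  pr (before_output m) (before_output m s) =
  pr W (W s) * pr (history V m) (history V m s) * \prod_(i < m) gain i s.
Proof.
move=> + s0; elim: m => [_|m IH mn].
  (* At time 0 the past is [W] together with [X 0], which is a function of [W] because no feedback
     exists yet. *)
  rewrite big_ord0 mulr1 (@pr_cst _ (history V 0)) ?mulr1; last first.
    by move=> s'; exact: history0_eq.
  apply: pr_eq_fiber => s' s'0; rewrite !pair_rv_eqP; split=> [[[[]]]//|e].
  do !split => //; try exact: history0_eq.
  by apply: encoder_fiber => //; exact: history0_eq.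
have ltmn : (m < n)%N by rewrite (leq_trans mn)// leq_pred.
rewrite pr_noise_history// big_ord_recr/=.
transitivity (pr (before_output m) (before_output m s) * gain m s *
    noise (history V m s) (V m s)); last by rewrite IH 1?ltnW//; ring.
rewrite -pr_output//.
have -> : pr (pair_rv (Y m) (before_output m)) (Y m s, before_output m s) =
    pr (before_noise m) (before_noise m s).
  apply: (@pr_eq_fiber _ _ (pair_rv (Y m) (before_output m))) => s' _.
  rewrite !pair_rv_eqP (historyS_eqP Y); tauto.
rewrite -pr_noise//.
(* The two tuples differ by the input [X m.+1], which the encoder recovers from the message and the
   first [m.+1] feedback symbols. *)
apply: (@pr_eq_fiber _ _ _ (pair_rv (V m) (before_noise m))) => s' s'0.
rewrite !pair_rv_eqP (historyS_eqP V); split; last first.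
  move=> [eV [[[eW _] eY] eVm]]; do !split => //.
  apply: encoder_fiber => //=; last by apply/historyS_eqP.
  by rewrite -(prednK n_gt0) ltnS.
move=> [[[eW eX] eY] [eV eVm]]; do !split => //.
exact: history_eq_le eX.
Qed.

(** The block ends with an output and no noise symbol, so one more gain completes the product; the
    inputs are then dropped, since the encoder determines them. *)
Lemma pr_message_noise_output (s : Om) : mu s != 0 ->
  pr (pair_rv (pair_rv W (history V n.-1)) (history Y n))
    (W s, history V n.-1 s, history Y n s) =
  pr W (W s) * pr (history V n.-1) (history V n.-1 s) * \prod_(i < n) gain i s.
Proof.
move=> s0; have n1 : (n.-1 < n)%N by rewrite prednK.
have -> : \prod_(i < n) gain i s = (\prod_(i < n.-1) gain i s) * gain n.-1 s.
  have recr m : \prod_(i < m.+1) gain i s = (\prod_(i < m) gain i s) * gain m s.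
    by rewrite big_ord_recr.
  by have := recr n.-1; rewrite prednK.
rewrite mulrA -pr_joint_history// -pr_output//.
apply: (@pr_eq_fiber _ _ (pair_rv (pair_rv W (history V n.-1)) (history Y n))
  (pair_rv (Y n.-1) (before_output n.-1))) => s' s'0.
rewrite /before_output (prednK n_gt0).
have := historyS_eqP Y n.-1 s' s; rewrite (prednK n_gt0) => eYn.
rewrite !pair_rv_eqP eYn; split=> [[[eW eV] [eY eYm]]|]; last by tauto.
by do !split => //; apply: encoder_fiber.
Qed.

(** The density is p(y_i | x^i, y^(i-1)) / p(y_i | y^(i-1)); its denominator is written as a
    quotient of output block probabilities to prepare for telescoping. *)
Lemma output_input_gain (i : nat) (s : Om) : (i < n)%N -> mu s != 0 ->
  let p := pr (history Y i) (history Y i s) in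
  pr (pair_rv (pair_rv (history X i.+1) (Y i)) (history Y i))
    (history X i.+1 s, Y i s, history Y i s) / p /
  (pr (pair_rv (history X i.+1) (history Y i)) (history X i.+1 s, history Y i s) / p
   * (pr (pair_rv (Y i) (history Y i)) (Y i s, history Y i s) / p)) =
  gain i s * (p / pr (history Y i.+1) (history Y i.+1 s)).
Proof.
move=> ni s0 p.
have p0 : p != 0 by rewrite gt_eqF ?pr_gt0.
have -> : pr (pair_rv (pair_rv (history X i.+1) (Y i)) (history Y i))
    (history X i.+1 s, Y i s, history Y i s) =
    pr (pair_rv (history X i.+1) (history Y i)) (history X i.+1 s, history Y i s)
    * gain i s.
  rewrite -pr_output_input//.
  apply: (@pr_eq_fiber _ _ (pair_rv (pair_rv (history X i.+1) (Y i)) (history Y i))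
    (pair_rv (Y i) (pair_rv (history X i.+1) (history Y i)))) => s' _.
  by rewrite !pair_rv_eqP; tauto.
have -> : pr (pair_rv (Y i) (history Y i)) (Y i s, history Y i s) =
    pr (history Y i.+1) (history Y i.+1 s).
  apply: (@pr_eq_fiber _ _ (pair_rv (Y i) (history Y i))) => s' _.
  by rewrite historyS_eqP pair_rv_eqP.
have := pr_gt0 (pair_rv (history X i.+1) (history Y i)) s0.
have := pr_gt0 (history Y i.+1) s0.
rewrite /pair_rv => /gt_eqF/negbT q0 /gt_eqF/negbT r0.
by field; rewrite p0 q0.
Qed.

Lemma gain_gt0 (i : nat) (s : Om) : (i < n)%N -> mu s != 0 -> 0 < gain i s.
Proof.
move=> ni s0.
have := pr_gt0 (pair_rv (Y i) (pair_rv (history X i.+1) (history Y i))) s0.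
by rewrite {2}/pair_rv pr_output_input// pmulr_rgt0// pr_gt0.
Qed.

(** Each side is the logarithm of the product of the gains divided by p(y^n): on the left the output
    probabilities telescope, on the right the marginals cancel. *)
Lemma information_density (s : Om) : mu s != 0 ->
  let pY := pr (history Y n) (history Y n s) in
  let pWY := pr (pair_rv W (history Y n)) (W s, history Y n s) in
  let pVY := pr (pair_rv (history V n.-1) (history Y n))
               (history V n.-1 s, history Y n s) in
  let pV := pr (history V n.-1) (history V n.-1 s) in
  \sum_(i < n)
    log2 (pr (pair_rv (pair_rv (history X i.+1) (Y i)) (history Y i))
            (history X i.+1 s, Y i s, history Y i s)
            / pr (history Y i) (history Y i s) /
          (pr (pair_rv (history X i.+1) (history Y i))
             (history X i.+1 s, history Y i s) / pr (history Y i) (history Y i s)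
           * (pr (pair_rv (Y i) (history Y i)) (Y i s, history Y i s)
              / pr (history Y i) (history Y i s)))) =
  log2 (pWY / (pr W (W s) * pY)) + log2 (pVY / (pV * pY)) +
  log2 (pr (pair_rv (pair_rv W (history V n.-1)) (history Y n))
          (W s, history V n.-1 s, history Y n s) / pY / (pWY / pY * (pVY / pY))).
Proof.
move=> s0 pY pWY pVY pV.
have prod_gt0 m : (m <= n)%N -> 0 < \prod_(i < m) gain i s.
  by move=> mn; apply: prodr_gt0 => i _; rewrite gain_gt0// (leq_trans _ mn).
have telescope m : (m <= n)%N -> \sum_(i < m) log2 (gain i s *
    (pr (history Y i) (history Y i s) / pr (history Y i.+1) (history Y i.+1 s))) =
    log2 ((\prod_(i < m) gain i s) / pr (history Y m) (history Y m s)).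
  elim: m => [_|m IH mn].
    (* The telescoping starts from the empty output history, of probability 1. *)
    rewrite !big_ord0 pr_cst ?invr1 ?mulr1; first by rewrite /log2 ln1 mul0r.
    by move=> s'; exact: history0_eq.
  rewrite !big_ord_recr/= IH 1?ltnW// -log2M; last 2 first.
  - by rewrite divr_gt0 ?pr_gt0 ?prod_gt0// ltnW.
  - by rewrite mulr_gt0 ?gain_gt0// divr_gt0 ?pr_gt0.
  congr log2; field.
  by rewrite !gt_eqF ?pr_gt0.
rewrite (eq_bigr (fun i : 'I_n => log2 (gain i s * (pr (history Y i) (history Y i s)
   / pr (history Y i.+1) (history Y i.+1 s))))); last first.
  by move=> i _; rewrite output_input_gain.
rewrite telescope// pr_message_noise_output// -/pY -/pV.
have pY0 : 0 < pY by exact: pr_gt0.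
have pV0 : 0 < pV by exact: pr_gt0.
have pW0 : 0 < pr W (W s) by exact: pr_gt0.
have pWY0 : 0 < pWY by exact: (pr_gt0 (pair_rv W (history Y n)) s0).
have pVY0 : 0 < pVY.
  exact: (pr_gt0 (pair_rv (history V n.-1) (history Y n)) s0).
have g0 := prod_gt0 n (leqnn n).
(* Positivity of every factor merges the three logarithms into one. *)
rewrite -!log2M; try by do ?[assumption | apply: divr_gt0 | apply: mulr_gt0].
congr log2; field.
by rewrite !gt_eqF.
Qed.

End FiniteSpace.

(** * Passage from the probability space to the finite set of values of [S] *)

Section FiniteQuotient.
Context {d : measure_display} {T : measurableType d} {R : realType}.
Variable P : probability T R.

Lemma finite_rv_pair (A B : finType) (U : T -> A) (U' : T -> B) :
  finite_rv U -> finite_rv U' -> finite_rv (pair_rv U U').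
Proof.
move=> mU mU' [a b].
have -> : (pair_rv U U' @^-1` [set (a, b)] = U @^-1` [set a] `&` U' @^-1` [set b])%classic.
  by apply/seteqP; split=> t /= => [[-> ->]|[]]; rewrite /pair_rv => // -> ->.
exact: measurableI.
Qed.

Lemma finite_rv_history (A : finType) (U : nat -> T -> A) (m : nat) :
  (forall i, (i < m)%N -> finite_rv (U i)) -> finite_rv (history U m).
Proof.
move=> mU v.
have -> : (history U m @^-1` [set v] =
    \bigcap_(i in [set: 'I_m]) (U i @^-1` [set tnth v i]))%classic.
  apply/seteqP; split=> [t /= <- i _|t /= h]; first by rewrite /= tnth_mktuple.
  by apply: eq_from_tnth => i; rewrite tnth_mktuple; exact: h.
by apply: fin_bigcap_measurable => // i _; exact: mU.
Qed.

Lemma law_ge0 (A : Type) (U : T -> A) (a : A) : 0 <= law P U a.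
Proof. exact/fine_ge0/measure_ge0. Qed.

Context {A : finType}.
Variable S : T -> A.
Hypothesis S_rv : finite_rv S.

(** Turns a variable on [T] into one on the values of [S]. A value that is never attained gets the
    default [point], harmlessly, as its weight is 0. *)
Definition representative (s : A) : T := xget point (S @^-1` [set s])%classic.

Lemma representativeK (t : T) : S (representative (S t)) = S t.
Proof. exact: (@xgetPex _ point (S @^-1` [set S t])%classic (ex_intro _ t erefl)). Qed.

Let rep := representative.

(** As [U] factors through [S], its event is a finite disjoint union of fibres of [S], over which
    the measure is additive. *)
Lemma law_pr (B : eqType) (U : T -> B) (b : B) :
  (forall t u, S t = S u -> U t = U u) ->
  law P U b = pr (law P S) (U \o rep) b.
Proof.
move=> hU; have UE : (U @^-1` [set b] =
    \bigcup_(s in [set s | U (rep s) == b]) (S @^-1` [set s]))%classic.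
  apply/seteqP; split=> [t <-|t [s /eqP <- <-]] /=.
    by exists (S t) => //=; apply/eqP/hU; rewrite representativeK.
  by apply/hU; rewrite representativeK.
rewrite /law UE measure_fin_bigcup; last 3 first.
- exact: finite_finset.
- exact: trivIset_preimage1.
- by move=> s _; exact: S_rv.
rewrite -(@bigfs _ _ _ _ (index_enum A) (fun s => U (rep s) == b)) ?index_enum_uniq//.
  by rewrite /pr sum_fine// => s _; rewrite fin_num_measure//; exact: S_rv.
by move=> s _; rewrite mem_index_enum.
Qed.

Lemma law_sum1 : \sum_s law P S s = 1.
Proof.
(* The total mass is the law of a constant variable. *)
have := @law_pr _ (fun=> tt) tt (fun _ _ _ => erefl).
rewrite /law [X in P X](_ : _ = setT); last by apply/seteqP.
by rewrite probability_setT/= => ->; apply: eq_bigl.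
Qed.

(** A fibre of positive probability is not negligible, so it meets every almost sure event. This
    makes the almost sure encoder equation usable on the finite set. *)
Lemma law_neq0_ae (s : A) (Q : T -> Prop) :
  {ae P, forall t, Q t} -> law P S s != 0 -> exists2 t, S t = s & Q t.
Proof.
move=> aeQ; apply: contra_neqP => nQ.
have : P.-negligible (S @^-1` [set s])%classic.
  by apply: negligibleS aeQ => t /= St Qt; apply: nQ; exists t.
by rewrite /law => /negligibleP -> //; exact: S_rv.
Qed.

(** Becoming an expectation over the values of [S] gives all information quantities a common index
    set. *)
Lemma mutual_info_pr (B C : finType) (U : T -> B) (U' : T -> C) :
  (forall t u, S t = S u -> U t = U u) ->
  (forall t u, S t = S u -> U' t = U' u) ->
  mutual_info P U U' = \sum_s law P S s *
    log2 (pr (law P S) (pair_rv (U \o rep) (U' \o rep)) (U (rep s), U' (rep s)) /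
      (pr (law P S) (U \o rep) (U (rep s)) * pr (law P S) (U' \o rep) (U' (rep s)))).
Proof.
move=> hU hU'; have hp t u : S t = S u -> pair_rv U U' t = pair_rv U U' u.
  by move=> e; apply/pair_rv_eqP; split; [exact: hU|exact: hU'].
rewrite /mutual_info pair_big/=.
rewrite -(pr_expectation (law P S) (pair_rv (U \o rep) (U' \o rep)) (fun p =>
  log2 (pr (law P S) (pair_rv (U \o rep) (U' \o rep)) (p.1, p.2) /
      (pr (law P S) (U \o rep) p.1 * pr (law P S) (U' \o rep) p.2)))).
by apply: eq_bigr => -[b c] _ /=; rewrite !law_pr.
Qed.

Lemma cond_mutual_info_pr (B C D : finType) (U : T -> B) (U' : T -> C) (Z : T -> D) :
  (forall t u, S t = S u -> U t = U u) ->
  (forall t u, S t = S u -> U' t = U' u) ->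
  (forall t u, S t = S u -> Z t = Z u) ->
  let u := U \o rep in let u' := U' \o rep in let z := Z \o rep in
  cond_mutual_info P U U' Z = \sum_s law P S s *
    log2 (pr (law P S) (pair_rv (pair_rv u u') z) (u s, u' s, z s)
            / pr (law P S) z (z s) /
      (pr (law P S) (pair_rv u z) (u s, z s) / pr (law P S) z (z s)
       * (pr (law P S) (pair_rv u' z) (u' s, z s) / pr (law P S) z (z s)))).
Proof.
move=> hU hU' hZ u u' z.
have hUU' t t' : S t = S t' -> pair_rv U U' t = pair_rv U U' t'.
  by move=> e; apply/pair_rv_eqP; split; [exact: hU|exact: hU'].
have hUZ t t' : S t = S t' -> pair_rv U Z t = pair_rv U Z t'.
  by move=> e; apply/pair_rv_eqP; split; [exact: hU|exact: hZ].
have hU'Z t t' : S t = S t' -> pair_rv U' Z t = pair_rv U' Z t'.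
  by move=> e; apply/pair_rv_eqP; split; [exact: hU'|exact: hZ].
have hUU'Z t t' : S t = S t' ->
    pair_rv (pair_rv U U') Z t = pair_rv (pair_rv U U') Z t'.
  by move=> e; apply/pair_rv_eqP; split; [exact: hUU'|exact: hZ].
rewrite /cond_mutual_info pair_big pair_big/=.
rewrite -(pr_expectation (law P S) (pair_rv (pair_rv u u') z) (fun p =>
  log2 (pr (law P S) (pair_rv (pair_rv u u') z) (p.1.1, p.1.2, p.2)
            / pr (law P S) z p.2 /
      (pr (law P S) (pair_rv u z) (p.1.1, p.2) / pr (law P S) z p.2
       * (pr (law P S) (pair_rv u' z) (p.1.2, p.2) / pr (law P S) z p.2))))).
by apply: eq_bigr => -[[b c] e] _ /=; rewrite /cond_law !law_pr.
Qed.

End FiniteQuotient.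

(** * Transfer of the channel to the finite set, and conclusion *)

Theorem corollary2 (d : measure_display) (T : measurableType d) (R : realType)
    (P : probability T R) (AW AX AY AV : finType) (G : zmodType)
    (n : nat) (hn : (0 < n)%N) (iY : AY -> G) (iV : AV -> G)
    (enc : forall i : nat, AW -> i.-tuple G -> AX)
    (chan : forall i : nat, i.+1.-tuple AX -> i.-tuple AY -> AY -> R)
    (noise : forall i : nat, i.-tuple AV -> AV -> R)
    (W : T -> AW) (X : nat -> T -> AX) (Y : nat -> T -> AY) (V : nat -> T -> AV)
    (hch : noise_feedback_channel P n iY iV enc chan noise W X Y V) :
  directed_info P X Y n =
    mutual_info P W (history Y n)
    + mutual_info P (history V n.-1) (history Y n)
    + cond_mutual_info P W (history V n.-1) (history Y n).
Proof.
case: hch => _ _ mW mX mY mV _ _ henc hchan hnoise.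
pose S := pair_rv (pair_rv (pair_rv W (history X n)) (history Y n)) (history V n.-1).
have S_rv : finite_rv S.
  by do !apply: finite_rv_pair => //; exact: finite_rv_history.
have SW t u : S t = S u -> W t = W u by case.
have SX m t u : (m <= n)%N -> S t = S u -> history X m t = history X m u.
  by move=> mn /pair_rv_eqP[/pair_rv_eqP[/pair_rv_eqP[_ e] _] _]; exact: history_eq_le e.
have SY m t u : (m <= n)%N -> S t = S u -> history Y m t = history Y m u.
  by move=> mn /pair_rv_eqP[/pair_rv_eqP[_ e] _]; exact: history_eq_le e.
have SV m t u : (m <= n.-1)%N -> S t = S u -> history V m t = history V m u.
  by move=> mn /pair_rv_eqP[_ e]; exact: history_eq_le e.
have SXi i t u : (i < n)%N -> S t = S u -> X i t = X i u.
  by move=> ni /(SX _ _ _ ni)/historyS_eqP[].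
have SYi i t u : (i < n)%N -> S t = S u -> Y i t = Y i u.
  by move=> ni /(SY _ _ _ ni)/historyS_eqP[].
have SVi i t u : (i < n.-1)%N -> S t = S u -> V i t = V i u.
  by move=> ni /(SV _ _ _ ni)/historyS_eqP[].
(* The feedback available at a time [i < n] uses noise at indices below [n.-1] only, all recorded in
   [S]. *)
have lt_le_pred i : (i < n)%N -> (i <= n.-1)%N by rewrite -[X in (_ < X)%N](prednK hn).
pose rep := representative S.
have encoder i : (i < n)%N -> forall s, law P S s != 0 -> (X i \o rep) s =
    enc i ((W \o rep) s)
      (history (noisy_feedback iY iV (fun j => Y j \o rep) (fun j => V j \o rep)) i s).
  (* The equation may fail at the representative itself; it holds at some [t] of the same fibre, and
     both of its sides depend on [S t] only. *)
  move=> ni s /(law_neq0_ae S_rv (henc i ni))[t <- e] /=.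
  have eS : S (rep (S t)) = S t by exact: representativeK.
  rewrite (SXi _ _ _ ni eS) e (SW _ _ eS); congr enc.
  apply: eq_from_tnth => j; rewrite !tnth_mktuple /noisy_feedback /=.
  have ji := ltn_ord j.
  by rewrite (SYi _ _ _ (ltn_trans ji ni) eS) (SVi _ _ _ (leq_trans ji (lt_le_pred _ ni)) eS).
(* Used with [j = i] for the past of an output and with [j = i.+1] for the past of a noise
   symbol. *)
have Spast i j t u : (i < n)%N -> (j <= n)%N -> S t = S u ->
    pair_rv (pair_rv (pair_rv W (history X i.+1)) (history Y j)) (history V i) t =
    pair_rv (pair_rv (pair_rv W (history X i.+1)) (history Y j)) (history V i) u.
  move=> ni jn e; rewrite !pair_rv_eqP; do !split.
  - exact: SW.
  - exact: SX.
  - exact: SY.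
  - by apply: SV => //; exact: lt_le_pred.
have channel i : (i < n)%N -> forall a y,
    let past := pair_rv (pair_rv (pair_rv (W \o rep)
      (history (fun j => X j \o rep) i.+1)) (history (fun j => Y j \o rep) i))
      (history (fun j => V j \o rep) i) in
    pr (law P S) past a != 0 ->
    pr (law P S) (pair_rv (Y i \o rep) past) (y, a) / pr (law P S) past a =
    chan i a.1.1.2 a.1.2 y.
  move=> ni [[[w xs] ys] vs] y /= a0.
  have Sp t u := @Spast i i t u ni (ltnW ni).
  rewrite -(hchan i ni w xs ys vs y) /cond_law; last by rewrite (law_pr P S_rv).
  rewrite !(law_pr P S_rv)// => t u e.
  by apply/pair_rv_eqP; split; [exact: SYi|exact: Sp].
have noiseP i : (i < n.-1)%N -> forall a v,
    let past := pair_rv (pair_rv (pair_rv (W \o rep)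
      (history (fun j => X j \o rep) i.+1)) (history (fun j => Y j \o rep) i.+1))
      (history (fun j => V j \o rep) i) in
    pr (law P S) past a != 0 ->
    pr (law P S) (pair_rv (V i \o rep) past) (v, a) / pr (law P S) past a =
    noise i a.2 v.
  move=> ni [[[w xs] ys] vs] v /= a0.
  have ni' : (i < n)%N by rewrite (leq_trans ni)// leq_pred.
  have Sp t u := @Spast i i.+1 t u ni' ni'.
  rewrite -(hnoise i ni w xs ys vs v) /cond_law; last by rewrite (law_pr P S_rv).
  rewrite !(law_pr P S_rv)// => t u e.
  by apply/pair_rv_eqP; split; [exact: SVi|exact: Sp].
have SYn t u := @SY n t u (leqnn n).
have SVn t u := @SV n.-1 t u (leqnn n.-1).
rewrite (mutual_info_pr P S_rv SW SYn) (mutual_info_pr P S_rv SVn SYn).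
rewrite (cond_mutual_info_pr P S_rv SW SVn SYn) -!big_split /=.
rewrite /directed_info (eq_bigr _ (fun (i : 'I_n) _ => cond_mutual_info_pr P S_rv
  (fun t u => @SX i.+1 t u (ltn_ord i)) (fun t u => @SYi i t u (ltn_ord i))
  (fun t u => @SY i t u (ltnW (ltn_ord i))))).
(* With the sum over time moved inside the expectation, the identity is compared value by value of
   [S]. *)
rewrite exchange_big/=; apply: eq_bigr => s _; rewrite -mulr_sumr -!mulrDr.
have [->|s0] := eqVneq (law P S s) 0; first by rewrite !mul0r.
congr (_ * _).
exact: (information_density (law_ge0 P S) (law_sum1 P S_rv) hn encoder channel noiseP s0).
Qed.
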